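(* Let $X,Y,Z$ be normed $c_0$-modules, and let $\varphi:X\to Y$ be a topologically injective morphism. Then the operator $\varphi\otimes_{c_0}\mathbf{1}_Z:X\otimes_{c_0}Z\to Y\otimes_{c_0}Z$ is injective.
   Context: All spaces are complex; normed spaces and modules are not assumed complete. $c_0$ is the Banach algebra of complex sequences converging to $0$, with coordinate-wise operations and the uniform norm. A normed $c_0$-module is a normed space $X$ that is a $c_0$-module and is contractive: $\|a\cdot x\|\le\|a\|\|x\|$ (all normed modules are assumed contractive; since $c_0$ is commutative, left and right modules are identified). A morphism is a linear map commuting with the module multiplication. A bounded morphism $\varphi$ is topologically injective if it is a topological isomorphism onto its image, i.e. there is $c>0$ with $\|\varphi(x)\|\ge c\|x\|$ for all $x$. For normed $c_0$-modules $X,Z$, the (non-completed) projective module tensor product $X\otimes_{c_0}Z$ is the quotient normed space of the non-completed projective tensor product $X\otimes_p Z$ of normed spaces by the closure of the linear span of all elements $(a\cdot x)\otimes z-x\otimes(a\cdot z)$, $a\in c_0,x\in X,z\in Z$. The image of $x\otimes z$ is denoted $x\otimes_{c_0}z$. For a bounded morphism $\varphi:X\to Y$, the operator $\varphi\otimes_{c_0}\mathbf{1}_Z$ is well defined by $x\otimes_{c_0}z\mapsto\varphi(x)\otimes_{c_0}z$. *)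

(* Defs.v *)
From HB Require Import structures.
From mathcomp Require Import all_boot all_order all_algebra.
From mathcomp Require Import complex.
From mathcomp Require Import all_classical all_reals topology normedtype.
From mathcomp Require Import freeg.

Set Implicit Arguments.
Unset Strict Implicit.
Unset Printing Implicit Defensive.

Import Order.TTheory GRing.Theory Num.Theory.

Local Open Scope classical_set_scope.
Local Open Scope ring_scope.
Local Open Scope complex_scope.
Local Open Scope quotient_scope.

Section QuotientModule.
Variables (K : nzRingType) (V : lmodType K) (S : submodClosed V).

Let submod_zmod_closed : zmod_closed S.
Proof.
split=> [|u v Su Sv]; first exact: rpred0.
by rewrite -[- v]scaleN1r rpredD// rpredZ.
Qed.

(* The library does not derive closure under opposite from submodClosed. *)
Definition submod_zmodClosed : zmodClosed V :=
  HB.pack (fun v => v \in S)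
    (GRing.isZmodClosed.Build V (fun v => v \in S) submod_zmod_closed).

Definition quotmod := Quotient.quot submod_zmodClosed.
HB.instance Definition _ := GRing.Zmodule.on quotmod.

Definition qpi (v : V) : quotmod := \pi_(Quotient.quot submod_zmodClosed) v.
Definition qrepr (q : quotmod) : V := repr (q : Quotient.quot submod_zmodClosed).

Lemma qreprK : cancel qrepr qpi.
Proof. by move=> q; exact: reprK. Qed.

Lemma qpi_eq u v : (qpi u = qpi v) <-> (u - v \in S).
Proof.
by rewrite (Quotient.idealrBE submod_zmodClosed); split => [/eqP//|/eqP].
Qed.

Lemma qpiD : {morph qpi : u v / u + v}.
Proof. by move=> u v; rewrite /qpi Quotient.pi_add. Qed.

Lemma qpiN : {morph qpi : u / - u}.
Proof. by move=> u; rewrite /qpi Quotient.pi_opp. Qed.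

Definition qscale (k : K) (q : quotmod) : quotmod := qpi (k *: qrepr q).

Lemma qpiZ k v : qpi (k *: v) = qscale k (qpi v).
Proof. by apply/qpi_eq; rewrite -scalerBr rpredZ//; apply/qpi_eq; rewrite qreprK. Qed.

Let qscaleA a b q : qscale a (qscale b q) = qscale (a * b) q.
Proof. by rewrite -[q]qreprK -!qpiZ scalerA. Qed.
Let qscale1 q : qscale 1 q = q.
Proof. by rewrite -[q]qreprK -!qpiZ scale1r. Qed.
Let qscaleDr a : {morph qscale a : q r / q + r}.
Proof. by move=> q r; rewrite -[q]qreprK -[r]qreprK -qpiD -!qpiZ scalerDr qpiD. Qed.
Let qscaleDl q : {morph qscale^~ q : a b / a + b}.
Proof. by move=> a b; rewrite -[q]qreprK -!qpiZ scalerDl qpiD. Qed.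

HB.instance Definition _ := GRing.Zmodule_isLmodule.Build K quotmod
  qscaleA qscale1 qscaleDr qscaleDl.

Lemma qpi_is_linear : linear qpi.
Proof. by move=> a u v; rewrite qpiD qpiZ. Qed.

HB.instance Definition _ := GRing.isLinear.Build K V quotmod _ qpi qpi_is_linear.

End QuotientModule.

Section Span.
Variables (K : nzRingType) (V : lmodType K).

Definition lspan (A : set V) : {pred V} := [pred v | `[< exists s : seq (K * V),
  (forall p, p \in s -> A p.2) /\ v = \sum_(p <- s) p.1 *: p.2 >]].

Lemma lspan_is_submod A : submod_closed (lspan A).
Proof.
split=> [|a u v /asboolP[s [sA ->]] /asboolP[t [tA ->]]].
  by apply/asboolP; exists [::]; split => //; rewrite big_nil.
apply/asboolP; exists ([seq (a * p.1, p.2) | p <- s] ++ t); split.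
  move=> p; rewrite mem_cat => /orP[/mapP[q /sA qA ->]//|]; exact: tA.
rewrite big_cat big_map/= scaler_sumr; congr (_ + _).
by apply: eq_bigr => p _; rewrite scalerA.
Qed.

HB.instance Definition _ A := GRing.isSubmodClosed.Build K V (lspan A)
  (lspan_is_submod A).

Lemma sub_lspan A v : A v -> v \in lspan A.
Proof.
move=> Av; apply/asboolP; exists [:: (1, v)]; split.
  by move=> p; rewrite inE => /eqP ->.
by rewrite big_seq1 scale1r.
Qed.

Lemma lspan_min A (S : submodClosed V) : (forall v, A v -> v \in S) ->
  forall v, v \in lspan A -> v \in S.
Proof.
move=> AS v /asboolP[s [sA ->]]; rewrite big_seq rpred_sum// => p /sA /AS.
exact: rpredZ.
Qed.

End Span.

Section Tensor.
Variables (K : fieldType) (X Z : lmodType K).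

Local Notation free := {freeg (X * Z) / K}.
Local Notation gen x z := (<< (x, z) >> : free).

Definition bilinear_rel : set free := [set w |
  (exists x y z, w = gen (x + y) z - gen x z - gen y z) \/
  (exists x z t, w = gen x (z + t) - gen x z - gen x t) \/
  (exists k x z, w = gen (k *: x) z - k *: gen x z) \/
  (exists k x z, w = gen x (k *: z) - k *: gen x z)].

Definition tensor := quotmod (lspan bilinear_rel).
HB.instance Definition _ := GRing.Lmodule.on tensor.

Definition tens (x : X) (z : Z) : tensor := qpi (lspan bilinear_rel) (gen x z).

Lemma tensDl x y z : tens (x + y) z = tens x z + tens y z.
Proof.
rewrite /tens -qpiD; apply/qpi_eq/sub_lspan; left; exists x, y, z.
by rewrite opprD addrA.
Qed.

Lemma tensDr x z t : tens x (z + t) = tens x z + tens x t.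
Proof.
rewrite /tens -qpiD; apply/qpi_eq/sub_lspan; right; left; exists x, z, t.
by rewrite opprD addrA.
Qed.

Lemma tensZl k x z : tens (k *: x) z = k *: tens x z.
Proof.
rewrite /tens -linearZ; apply/qpi_eq/sub_lspan.
by right; right; left; exists k, x, z.
Qed.

Lemma tensZr k x z : tens x (k *: z) = k *: tens x z.
Proof.
rewrite /tens -linearZ; apply/qpi_eq/sub_lspan.
by right; right; right; exists k, x, z.
Qed.

Lemma tens0l z : tens 0 z = 0.
Proof. by rewrite -[0 in LHS](scale0r (0 : X)) tensZl scale0r. Qed.

Lemma tens_sum (t : tensor) :
  exists s : seq (X * Z), t = \sum_(p <- s) tens p.1 p.2.
Proof.
rewrite -[t]qreprK; move: (qrepr t) => w; rewrite -[w]freeg_sumE.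
exists [seq (coeff p w *: p.1, p.2) | p <- dom w].
rewrite [RHS]big_map [LHS]linear_sum/=.
apply: eq_bigr => -[x z] _ /=.
rewrite tensZl /tens -linearZ; congr (qpi _ _).
by apply/eqP/freeg_eqP => p; rewrite coeffZ !coeffU mul1r.
Qed.

Section Lift.
Variables (W : lmodType K) (b : X -> Z -> W).

Definition tlift (t : tensor) : W := fglift (fun p => b p.1 p.2) (qrepr t).

Hypotheses (bDl : forall x y z, b (x + y) z = b x z + b y z)
  (bDr : forall x z t, b x (z + t) = b x z + b x t)
  (bZl : forall k x z, b (k *: x) z = k *: b x z)
  (bZr : forall k x z, b x (k *: z) = k *: b x z).

Let L : free -> W := fglift (fun p => b p.1 p.2).

Let L_gen x z : L (gen x z) = b x z.
Proof. by rewrite /L liftU scale1r. Qed.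

Let L_sub u v : L (u - v) = L u - L v.
Proof. exact: lift_is_additive. Qed.

Let L_linear : linear L.
Proof.
have L0 : L 0 = 0 by rewrite -(subrr 0) L_sub subrr.
have LN u : L (- u) = - L u by rewrite -[- u]sub0r L_sub L0 sub0r.
have LD u v : L (u + v) = L u + L v by rewrite -[v in LHS]opprK L_sub LN opprK.
move=> k u v; rewrite LD; congr (_ + _).
rewrite -[u in RHS]freeg_sumE -[u in LHS]freeg_sumE.
have Lsum (s : seq (X * Z)) (F : X * Z -> free) :
    L (\sum_(p <- s) F p) = \sum_(p <- s) L (F p).
  by elim: s => [|p s ih]; rewrite ?big_nil// !big_cons LD ih.
rewrite scaler_sumr !Lsum scaler_sumr; apply: eq_bigr => p _.
have -> : k *: << coeff p u *g p >> = << k * coeff p u *g p >> :> free.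
  by apply/eqP/freeg_eqP => q; rewrite coeffZ !coeffU mulrA.
by rewrite /L !liftU scalerA.
Qed.

HB.instance Definition _ := GRing.isLinear.Build K free W _ L L_linear.

Lemma tlift_qpi w : tlift (qpi _ w) = fglift (fun p => b p.1 p.2) w.
Proof.
apply/eqP; rewrite -subr_eq0 -L_sub; apply/eqP.
have /asboolP[s [sR ->]] : qrepr (qpi (lspan bilinear_rel) w) - w \in lspan bilinear_rel.
  by apply/qpi_eq; rewrite qreprK.
rewrite linear_sum big_seq big1// => p /sR pR; rewrite linearZ/=.
suff -> : L p.2 = 0 by rewrite scaler0.
move: pR => [|[|[]]].
- by move=> [x [y [z ->]]]; rewrite !linearB/= !L_gen bDl -addrA -opprD subrr.
- by move=> [x [z [t ->]]]; rewrite !linearB/= !L_gen bDr -addrA -opprD subrr.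
- by move=> [k [x [z ->]]]; rewrite linearB linearZ/= !L_gen bZl subrr.
- by move=> [k [x [z ->]]]; rewrite linearB linearZ/= !L_gen bZr subrr.
Qed.

Lemma tlift_is_linear : linear tlift.
Proof.
move=> k s t; rewrite -[s]qreprK -[t]qreprK -linearP !tlift_qpi.
exact: L_linear.
Qed.

Lemma tliftE x z : tlift (tens x z) = b x z.
Proof. by rewrite tlift_qpi; exact: L_gen. Qed.

End Lift.

End Tensor.

Section Norms.
Variable R : realType.

Section RealNorm.
Variable V : normedModType R[i].

(* The library's norm of a normed module over R[i] takes values in R[i]. *)
Definition rnorm (v : V) : R := complex.Re `|v|.

Lemma rnormE v : (rnorm v)%:C = `|v|.
Proof. exact: RRe_real (normr_real v). Qed.

Lemma rnorm_ge0 v : 0 <= rnorm v.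
Proof. by rewrite -ler0c rnormE. Qed.

Lemma rnormD u v : rnorm (u + v) <= rnorm u + rnorm v.
Proof. by rewrite -lecR rmorphD/= !rnormE ler_normD. Qed.

Lemma rnormZ (k : R[i]) v : rnorm (k *: v) = complex.Re `|k| * rnorm v.
Proof.
by apply: complexI; rewrite rmorphM/= !rnormE normrZ (RRe_real (normr_real k)).
Qed.

Lemma rnorm0_eq0 v : rnorm v = 0 -> v = 0.
Proof. by move=> v0; apply/normr0_eq0; rewrite -rnormE v0. Qed.

End RealNorm.

Lemma Rnorm_ge0 (k : R[i]) : 0 <= complex.Re `|k|.
Proof. by rewrite -ler0c (RRe_real (normr_real k)) normr_ge0. Qed.

Section InfimumNorm.
Variables (V : lmodType R[i]) (cost : V -> set R).
Hypotheses (cost_ne : forall v, cost v !=set0)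
  (cost_ge0 : forall v r, cost v r -> 0 <= r)
  (costD : forall u v r s, cost u r -> cost v s -> cost (u + v) (r + s))
  (costZ : forall k v r, cost v r -> cost (k *: v) (complex.Re `|k| * r)).

Lemma inf_cost_le v r : cost v r -> inf (cost v) <= r.
Proof. by move=> vr; apply: ge_inf => //; exists 0 => s /cost_ge0. Qed.

Lemma inf_cost_ge v r : (forall s, cost v s -> r <= s) -> r <= inf (cost v).
Proof. by move=> h; apply: lb_le_inf. Qed.

Lemma inf_cost_ge0 v : 0 <= inf (cost v).
Proof. by apply: inf_cost_ge => s /cost_ge0. Qed.

Lemma inf_costD u v : inf (cost (u + v)) <= inf (cost u) + inf (cost v).
Proof.
rewrite -lerBlDr; apply: inf_cost_ge => r ur.
rewrite lerBlDr -lerBlDl; apply: inf_cost_ge => s vs.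
by rewrite lerBlDl; apply: inf_cost_le; exact: costD.
Qed.

Lemma inf_costZ k v : inf (cost (k *: v)) = complex.Re `|k| * inf (cost v).
Proof.
have [->|k0] := eqVneq k 0.
  rewrite normr0 mul0r; apply/eqP; rewrite eq_le inf_cost_ge0 andbT.
  have [r vr] := cost_ne v; apply: inf_cost_le.
  by have := costZ 0 vr; rewrite normr0 mul0r.
have nk0 : 0 < complex.Re `|k|.
  by rewrite -ltcR (RRe_real (normr_real k)) normr_gt0.
have le1 l w : inf (cost (l *: w)) <= complex.Re `|l| * inf (cost w).
  have [->|l0] := eqVneq l 0.
    rewrite normr0 mul0r; have [r wr] := cost_ne w; apply: inf_cost_le.
    by have := costZ 0 wr; rewrite normr0 mul0r.
  have nl0 : 0 < complex.Re `|l|.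
    by rewrite -ltcR (RRe_real (normr_real l)) normr_gt0.
  rewrite -ler_pdivrMl//; apply: inf_cost_ge => r wr.
  by rewrite ler_pdivrMl//; apply: inf_cost_le; exact: costZ.
apply/eqP; rewrite eq_le le1/= -ler_pdivlMl//.
have := le1 k^-1 (k *: v); rewrite scalerA mulVf// scale1r => /le_trans; apply.
suff -> : complex.Re `|k^-1| = (complex.Re `|k|)^-1 by [].
apply: complexI; rewrite fmorphV/= (RRe_real (normr_real k)) (RRe_real (normr_real k^-1)).
exact: normfV.
Qed.

Definition infnorm (v : V) : R[i] := (inf (cost v))%:C.

Lemma infnormD u v : infnorm (u + v) <= infnorm u + infnorm v.
Proof. by rewrite /infnorm -rmorphD lecR inf_costD. Qed.

Lemma infnormZ k v : infnorm (k *: v) = `|k| * infnorm v.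
Proof. by rewrite /infnorm inf_costZ rmorphM/= (RRe_real (normr_real k)). Qed.

End InfimumNorm.

Section HahnBanach.
Variable X : lmodType R[i].

Definition sublinear (q : X -> R) := (forall x y, q (x + y) <= q x + q y) /\
  (forall (r : R) x, 0 <= r -> q (r%:C *: x) = r * q x).

Lemma sublinear0 (q : X -> R) : sublinear q -> q 0 = 0.
Proof. by move=> [_ qZ]; rewrite -(scale0r 0) -[0 in LHS]/(0%:C) qZ// mul0r. Qed.

Lemma sublinearN (q : X -> R) x : sublinear q -> - q (- x) <= q x.
Proof.
by move=> qS; rewrite lerNl -subr_ge0 opprK -(sublinear0 qS) -(addNr x) qS.1.
Qed.

Lemma sublinearI (q : X -> R) : (forall x y, q (x + y) <= q x + q y) ->
  (forall (r : R) x, 0 <= r -> q (r%:C *: x) <= r * q x) -> sublinear q.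
Proof.
move=> qD qZ; split=> // r x; rewrite le_eqVlt => /predU1P[<-|r0].
  rewrite mul0r scale0r; apply/eqP; rewrite eq_le; apply/andP; split.
    by have := qZ 0 0 (lexx _); rewrite scale0r mul0r.
  by have := qD 0 0; rewrite addr0 lerDl.
apply/eqP; rewrite eq_le (qZ _ _ (ltW r0))/= -ler_pdivlMl//.
have := qZ r^-1 (r%:C *: x); rewrite scalerA -rmorphM/= mulVf ?gt_eqF//.
by rewrite scale1r; apply; rewrite invr_ge0 ltW.
Qed.

(* A sublinear functional that is minimal equals all its shifts, hence is odd;
   this is the core of the Hahn-Banach theorem. *)
Definition qshift (q : X -> R) (y x : X) : R :=
  inf [set s | exists r : R, 0 <= r /\ s = q (x + r%:C *: y) - r * q y].

Section Qshift.
Variables (q : X -> R) (y : X).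
Hypothesis qS : sublinear q.

Let lowb x (r : R) : 0 <= r -> - q (- x) <= q (x + r%:C *: y) - r * q y.
Proof.
move=> r0; rewrite lerBrDr addrC lerBlDr -qS.2//.
by apply: le_trans (qS.1 _ _); rewrite addrAC subrr add0r.
Qed.

Let qshift_le x (r : R) : 0 <= r -> qshift q y x <= q (x + r%:C *: y) - r * q y.
Proof.
move=> r0; apply: ge_inf; last by exists r.
by exists (- q (- x)) => _ [s [s0 ->]]; exact: lowb.
Qed.

Let qshift_ge x c :
  (forall r : R, 0 <= r -> c <= q (x + r%:C *: y) - r * q y) -> c <= qshift q y x.
Proof.
move=> h; apply: lb_le_inf; last by move=> _ [r [r0 ->]]; exact: h.
by exists (q (x + 0%:C *: y) - 0 * q y), 0.
Qed.

Lemma qshift_sublinear : sublinear (qshift q y).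
Proof.
apply: sublinearI => [u v|k x k0].
  rewrite -lerBlDr; apply: qshift_ge => r r0; rewrite lerBlDr -lerBlDl.
  apply: qshift_ge => s s0; rewrite lerBlDl.
  apply: le_trans (qshift_le _ (addr_ge0 r0 s0)) _.
  rewrite addrACA -opprD -mulrDl lerD2r rmorphD scalerDl addrACA.
  exact: qS.1.
move: k0; rewrite le_eqVlt => /predU1P[<-|k0].
  rewrite mul0r scale0r; apply: le_trans (qshift_le _ (lexx 0)) _.
  by rewrite scale0r addr0 mul0r subr0 sublinear0.
rewrite -ler_pdivrMl//; apply: qshift_ge => r r0; rewrite ler_pdivrMl//.
apply: le_trans (qshift_le _ (mulr_ge0 (ltW k0) r0)) _.
by rewrite rmorphM -scalerA -scalerDr (qS.2 _ _ (ltW k0)) mulrBr mulrA.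
Qed.

Lemma qshift_le_id x : qshift q y x <= q x.
Proof.
by apply: le_trans (qshift_le _ (lexx 0)) _; rewrite scale0r addr0 mul0r subr0.
Qed.

Lemma qshiftN : qshift q y (- y) <= - q y.
Proof.
apply: le_trans (qshift_le _ ler01) _.
by rewrite scale1r addNr mul1r sublinear0// sub0r.
Qed.

End Qshift.

Lemma minimal_sublinear (p : X -> R) : sublinear p ->
  exists q : X -> R, [/\ sublinear q, forall x, q x <= p x & forall x, q (- x) = - q x].
Proof.
move=> pS.
pose T := {q : X -> R | sublinear q /\ forall x, q x <= p x}.
pose L (s t : T) := `[< forall x, sval t x <= sval s x >].
have TS (t : T) : sublinear (sval t) by case: (svalP t).
have Tp (t : T) x : sval t x <= p x by case: (svalP t).
have Tlow (t : T) x : - p (- x) <= sval t x.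
  by apply: le_trans (sublinearN x (TS t)); rewrite lerN2.
have [| | |A Atot|t tmin] := @Zorn T L.
- by move=> t; apply/asboolP.
- move=> r s t /asboolP rs /asboolP st; apply/asboolP => x.
  exact: le_trans (st x) (rs x).
- move=> [s Ps] [t Pt] /asboolP st /asboolP ts; apply: eq_exist => /=.
  by apply/funext => x; apply/eqP; rewrite eq_le (st x) (ts x).
- have [[t0 At0]|A0] := pselect (exists t, A t); last first.
    exists (exist _ p (conj pS (fun x => lexx _))) => s As.
    by exfalso; apply: A0; exists s.
  pose m x := inf [set sval t x | t in A].
  have m_le t x : A t -> m x <= sval t x.
    move=> At; apply: ge_inf; last by exists t.
    by exists (- p (- x)) => _ [s As <-].
  have m_ge c x : (forall t, A t -> c <= sval t x) -> c <= m x.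
    move=> h; apply: lb_le_inf; first by exists (sval t0 x), t0.
    by move=> _ [s As <-]; exact: h.
  have mS : sublinear m.
    apply: sublinearI => [x y|k x k0].
      rewrite -lerBlDr; apply: (m_ge _ _) => s As; rewrite lerBlDr -lerBlDl.
      apply: (m_ge _ _) => t At; rewrite lerBlDl.
      have [/asboolP st|/asboolP ts] := Atot _ _ As At.
        apply: le_trans (m_le _ _ At) _; apply: le_trans ((TS t).1 _ _) _.
        by rewrite lerD2r.
      apply: le_trans (m_le _ _ As) _; apply: le_trans ((TS s).1 _ _) _.
      by rewrite lerD2l.
    move: k0; rewrite le_eqVlt => /predU1P[<-|k0].
      rewrite mul0r scale0r; apply: le_trans (m_le _ _ At0) _.
      by rewrite sublinear0.
    rewrite -ler_pdivrMl//; apply: (m_ge _ _) => s As; rewrite ler_pdivrMl//.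
    by apply: le_trans (m_le _ _ As) _; rewrite ((TS s).2 _ _ (ltW k0)).
  have mp x : m x <= p x by apply: le_trans (m_le _ _ At0) _.
  by exists (exist _ m (conj mS mp)) => s As; apply/asboolP => x /=; exact: m_le.
exists (sval t); split=> // y.
have qp x : qshift (sval t) y x <= p x.
  exact: le_trans (qshift_le_id y (TS t) x) (Tp t x).
have /(congr1 sval)/= qE := tmin (exist _ _ (conj (qshift_sublinear y (TS t)) qp))
  (asboolT (qshift_le_id y (TS t))).
apply/eqP; rewrite eq_le; apply/andP; split.
  by rewrite -{1}qE qshiftN.
by rewrite lerNl sublinearN.
Qed.

End HahnBanach.

Lemma separating_functional (X : normedModType R[i]) (x : X) : x != 0 ->
  exists f : X -> R[i]^o, [/\ linear f, f x = 1 &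
    exists M : R, forall y, `|f y| <= M%:C * `|y|].
Proof.
move=> x0.
have nS : sublinear (@rnorm X).
  split=> [|r y r0]; first exact: rnormD.
  rewrite rnormZ; congr (_ * _); apply: complexI.
  by rewrite (RRe_real (normr_real _)) ger0_norm// ler0c.
have [f [fS fle fN]] := minimal_sublinear (qshift_sublinear x nS).
have fn y : f y <= rnorm y by apply: le_trans (fle y) (qshift_le_id _ nS _).
have fx : 0 < f x.
  have : f (- x) <= - rnorm x by apply: le_trans (fle _) (qshiftN _ nS).
  rewrite fN lerN2; apply: lt_le_trans.
  by rewrite -ltcR rnormE normr_gt0.
have fD y z : f (y + z) = f y + f z.
  apply/eqP; rewrite eq_le fS.1/= -lerN2 opprD -!fN opprD; exact: fS.1.
have fZ (r : R) y : f (r%:C *: y) = r * f y.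
  have [r0|r0] := leP 0 r; first exact: fS.2.
  rewrite -[r]opprK rmorphN scaleNr fN fS.2 ?mulNr// oppr_ge0; exact: ltW.
pose g y : R[i] := f y +i* (- f ('i *: y)).
have gZ k y : g (k *: y) = k * g y.
  case: k => a b.
  have -> : (a +i* b) *: y = a%:C *: y + b%:C *: ('i *: y).
    by rewrite scalerA -scalerDl; congr (_ *: _); simpc.
  have iZ c w : 'i *: (c%:C *: w) = c%:C *: ('i *: w) :> X.
    by rewrite !scalerA mulrC.
  have iK w : 'i *: ('i *: w) = - w :> X.
    by rewrite scalerA -expr2 sqr_i scaleN1r.
  rewrite /g; simpc; rewrite scalerDr !iZ iK !fD !fZ fN mulrN opprD opprK.
  by [].
have gx : g x != 0.
  by apply/eqP => /(congr1 (@complex.Re R))/= fx0; rewrite fx0 ltxx in fx.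
have gD y z : g (y + z) = g y + g z.
  by rewrite /g; simpc; rewrite scalerDr !fD opprD.
have fabs y : `|f y| <= rnorm y.
  rewrite ler_norml fn andbT lerNl -fN; apply: le_trans (fn _) _.
  by rewrite -lecR !rnormE normrN.
exists (fun y => (g x)^-1 * g y : R[i]); split.
- move=> k y z /=; rewrite gD gZ mulrDr; congr (_ + _).
  by rewrite /GRing.scale/= mulrCA.
- by rewrite mulVf.
exists (complex.Re `|(g x)^-1| * 2) => y.
have normR (r : R) : `|r%:C| = `|r|%:C :> R[i].
  by rewrite normc_def/= expr0n/= addr0 sqrtr_sqr.
have normi : `|'i : R[i]| = 1 by rewrite normc_def/= expr0n/= expr1n add0r sqrtr1.
have gE : (complex.Re `|(g x)^-1|)%:C = `|(g x)^-1| := RRe_real (normr_real _).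
rewrite [leLHS](normrM (g x)^-1) rmorphM/= gE -mulrA ler_wpM2l//.
rewrite -rnormE -rmorphM/= mulr2n mulrDl mul1r rmorphD/=.
have -> : g y = (f y)%:C - 'i * (f ('i *: y))%:C by rewrite /g; simpc.
apply: le_trans (ler_normB _ _) _; rewrite normrM normi mul1r !normR lerD ?lecR//.
apply: le_trans (fabs _) _; rewrite -lecR !rnormE normrZ normi mul1r//.
Qed.

End Norms.

Section ProjectiveTensor.
Variables (R : realType) (X Z : normedModType R[i]).

Definition ptensor := tensor X Z.
HB.instance Definition _ := GRing.Lmodule.on ptensor.

Definition ptens (x : X) (z : Z) : ptensor := tens x z.

Definition ptensor_cost (u : ptensor) : set R := [set r |
  exists s : seq (X * Z), u = \sum_(p <- s) ptens p.1 p.2 /\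
                          r = \sum_(p <- s) rnorm p.1 * rnorm p.2].

Definition ptensor_norm : ptensor -> R[i] := infnorm ptensor_cost.

Let cost_ne u : ptensor_cost u !=set0.
Proof.
have [s us] := tens_sum u.
by exists (\sum_(p <- s) rnorm p.1 * rnorm p.2), s.
Qed.

Let cost_ge0 u r : ptensor_cost u r -> 0 <= r.
Proof.
by move=> [s [_ ->]]; apply: sumr_ge0 => p _; rewrite mulr_ge0 ?rnorm_ge0.
Qed.

Let costD u v r s :
  ptensor_cost u r -> ptensor_cost v s -> ptensor_cost (u + v) (r + s).
Proof. by move=> [a [-> ->]] [b [-> ->]]; exists (a ++ b); rewrite !big_cat. Qed.

Let costZ k u r :
  ptensor_cost u r -> ptensor_cost (k *: u) (complex.Re `|k| * r).
Proof.
move=> [a [-> ->]]; exists [seq (k *: p.1, p.2) | p <- a]; rewrite !big_map/=.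
rewrite scaler_sumr mulr_sumr; split; apply: eq_bigr => p _.
  by rewrite /ptens tensZl.
by rewrite rnormZ mulrA.
Qed.

(* Definiteness, by induction on the number of terms of a representation
   x (x) z + s: contracting it with a bounded functional f such that f x = 1
   expresses z through the other factors and gives a shorter representation. *)
Let short_eq0 n (s : seq (X * Z)) : (size s <= n)%N ->
  ptensor_norm (\sum_(p <- s) ptens p.1 p.2) = 0 ->
  \sum_(p <- s) ptens p.1 p.2 = 0.
Proof.
elim: n s => [|n ih] [|[x z] s]//=; rewrite ?big_nil// ltnS => sn.
have [->|x0] := eqVneq x 0.
  by rewrite big_cons/= /ptens tens0l add0r; exact: ih.
have [f [flin fx [M fM]]] := separating_functional x0.
pose b (y : X) (t : Z) : Z := (f y : R[i]) *: t.
have fD x' y : f (x' + y) = f x' + f y by have := flin 1 x' y; rewrite !scale1r.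
have f0 : f 0 = 0 by apply: (addrI (f 0)); rewrite -fD !addr0.
have fZ k y : f (k *: y) = (k : R[i]) * f y.
  by have := flin k y 0; rewrite f0 !addr0.
have bDl x' y t : b (x' + y) t = b x' t + b y t by rewrite /b fD scalerDl.
have bDr y t t' : b y (t + t') = b y t + b y t' by rewrite /b scalerDr.
have bZl k y t : b (k *: y) t = k *: b y t by rewrite /b fZ scalerA.
have bZr k y t : b y (k *: t) = k *: b y t by rewrite /b !scalerA mulrC.
pose F : ptensor -> Z := tlift b.
have Flin : linear F := tlift_is_linear bDl bDr bZl bZr.
have FD u v : F (u + v) = F u + F v by have := Flin 1 u v; rewrite !scale1r.
have F0 : F 0 = 0 by apply: (addrI (F 0)); rewrite -FD !addr0.
have Fsum (l : seq (X * Z)) :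
    F (\sum_(p <- l) ptens p.1 p.2) = \sum_(p <- l) b p.1 p.2.
  elim: l => [|p l IH]; first by rewrite !big_nil.
  by rewrite !big_cons FD IH /F /ptens tliftE.
have M0 : 0 <= M.
  have := fM x; rewrite fx normr1 => h.
  have : 0 < M%:C * `|x| by apply: lt_le_trans h; exact: ltr01.
  by rewrite pmulr_lgt0 ?normr_gt0// ltcR => /ltW.
have Fbd u r : ptensor_cost u r -> rnorm (F u) <= M * r.
  move=> [l [-> ->]]; rewrite Fsum mulr_sumr.
  elim: l => [|p l IH].
    by rewrite !big_nil -lecR rnormE normr0.
  rewrite !big_cons; apply: le_trans (rnormD _ _) _; rewrite lerD//.
  rewrite /b rnormZ mulrA ler_wpM2r ?rnorm_ge0//.
  have := fM p.1; rewrite -rnormE -rmorphM -(RRe_real (normr_real (f p.1 : R[i]))).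
  by rewrite lecR.
move=> n0; set u := \sum_(p <- _) _ in n0 *.
have Fu0 : F u = 0.
  apply: rnorm0_eq0; apply/eqP; rewrite eq_le rnorm_ge0 andbT.
  have [M00|Mn0] := eqVneq M 0.
    have [r ur] := cost_ne u; have := Fbd _ _ ur.
    by rewrite M00 mul0r.
  have Mp : 0 < M by rewrite lt_neqAle eq_sym Mn0.
  have : M^-1 * rnorm (F u) <= inf (ptensor_cost u).
    by apply: lb_le_inf => // r ur; rewrite ler_pdivrMl//; exact: Fbd.
  have -> : inf (ptensor_cost u) = 0 by apply: complexI; exact: n0.
  by rewrite ler_pdivrMl// mulr0.
move: Fu0; rewrite /u Fsum big_cons {1}/b/= fx scale1r => /eqP.
rewrite addr_eq0 => /eqP zE.
pose s' := [seq (p.1 - f p.1 *: x, p.2) | p <- s].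
have uE : u = \sum_(p <- s') ptens p.1 p.2.
  rewrite /u big_cons/= zE big_map/=.
  have -> : ptens x (- (\sum_(j <- s) b j.1 j.2)) =
      \sum_(p <- s) - ptens (f p.1 *: x) p.2.
    elim: (s) => [|p l IH].
      by rewrite !big_nil oppr0 /ptens -(scale0r (0 : Z)) tensZr scale0r.
    rewrite !big_cons opprD -IH /ptens tensDr; congr (_ + _).
    by rewrite /b -scaleNr tensZr tensZl scaleNr.
  rewrite -big_split/=; apply: eq_bigr => p _.
  by rewrite /ptens addrC tensDl -[in RHS]scaleNr !tensZl scaleNr.
rewrite -/u uE; apply: ih; first by rewrite size_map.
by rewrite -uE.
Qed.

Let ptensor_norm_eq0 u : ptensor_norm u = 0 -> u = 0.
Proof. by have [s ->] := tens_sum u; exact: short_eq0 (leqnn _). Qed.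

HB.instance Definition _ := @Lmodule_isNormed.Build R[i] ptensor ptensor_norm
  (infnormD cost_ne cost_ge0 costD) (infnormZ cost_ne cost_ge0 costZ)
  ptensor_norm_eq0.

End ProjectiveTensor.

Section NormedQuotient.
Variables (R : realType) (V : normedModType R[i]) (A : set V).

Definition closed_lspan : {pred V} :=
  [pred v | `[< closure [set` lspan A] v >]].

Lemma closed_lspanP v : reflect
  (forall e : R[i], 0 < e -> exists2 w, w \in lspan A & `|v - w| < e)
  (v \in closed_lspan).
Proof.
apply: (iffP idP) => [/asboolP h e e0|h].
  have [w [/= wA]] := h _ (nbhsx_ballx v e e0).
  by rewrite -ball_normE; exists w.
apply/asboolP => B /nbhs_ballP[e /= e0 eB]; have [w wA vw] := h e e0.
by exists w; split => //; apply: eB; rewrite -ball_normE.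
Qed.

Lemma closed_lspan_is_submod : submod_closed closed_lspan.
Proof.
split=> [|k u v /closed_lspanP uA /closed_lspanP vA]; apply/closed_lspanP => e e0.
  by exists 0; rewrite ?rpred0// subrr normr0.
have e1 : 0 < e / 2 / (1 + `|k|).
  by rewrite !divr_gt0// ltr_wpDr.
have e2 : 0 < e / 2 by rewrite divr_gt0.
have [w wA uw] := uA _ e1; have [t tA vt] := vA _ e2.
exists (k *: w + t); first by rewrite rpredD ?rpredZ.
rewrite opprD addrACA -scalerBr [ltRHS]splitr.
apply: le_lt_trans (ler_normD _ _) _; rewrite ler_ltD// normrZ.
apply: (@le_trans _ _ ((1 + `|k|) * `|u - w|)).
  by rewrite ler_wpM2r// lerDr.
by rewrite -ler_pdivlMl ?ltr_wpDr// mulrC ltW.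
Qed.

HB.instance Definition _ := GRing.isSubmodClosed.Build R[i] V closed_lspan
  closed_lspan_is_submod.

Definition nquot := quotmod closed_lspan.
HB.instance Definition _ := GRing.Lmodule.on nquot.

Definition nqpi (v : V) : nquot := qpi closed_lspan v.

Definition nquot_cost (q : nquot) : set R :=
  [set r | exists v, nqpi v = q /\ r = rnorm v].

Definition nquot_norm : nquot -> R[i] := infnorm nquot_cost.

Let cost_ne q : nquot_cost q !=set0.
Proof. by exists (rnorm (qrepr q)), (qrepr q); split => //; exact: qreprK. Qed.

Let cost_ge0 q r : nquot_cost q r -> 0 <= r.
Proof. by move=> [v [_ ->]]; exact: rnorm_ge0. Qed.

Let costZ k q r : nquot_cost q r -> nquot_cost (k *: q) (complex.Re `|k| * r).
Proof.
by move=> [v [<- ->]]; exists (k *: v); rewrite rnormZ /nqpi linearZ.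
Qed.

Let nquot_normD p q : nquot_norm (p + q) <= nquot_norm p + nquot_norm q.
Proof.
rewrite /nquot_norm /infnorm -rmorphD lecR -lerBlDr; apply: lb_le_inf => //.
move=> _ [u [up ->]]; rewrite lerBlDr -lerBlDl; apply: lb_le_inf => //.
move=> _ [v [vq ->]]; rewrite lerBlDl; apply: le_trans (rnormD u v).
apply: ge_inf; first by exists 0 => r /cost_ge0.
by exists (u + v); rewrite -up -vq /nqpi linearD.
Qed.

Let nquot_norm_eq0 q : nquot_norm q = 0 -> q = 0.
Proof.
move=> q0; have {q0}i0 : inf (nquot_cost q) = 0 by apply: complexI.
rewrite -[q]qreprK -[RHS](linear0 (qpi closed_lspan)); apply/qpi_eq; rewrite subr0.
apply/closed_lspanP => e e0; set v := qrepr q.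
have e2 : 0 < e / 2 by rewrite divr_gt0.
have e2E : (complex.Re (e / 2))%:C = e / 2 by rewrite RRe_real// gtr0_real.
have e2r : 0 < complex.Re (e / 2) by rewrite -ltcR e2E.
have hi : has_inf (nquot_cost q) by split => //; exists 0 => r /cost_ge0.
have [_ [w [wq ->]]] := inf_adherent e2r hi.
rewrite i0 add0r -ltcR e2E rnormE => we.
have /closed_lspanP/(_ _ e2)[t tA vwt] : v - w \in closed_lspan.
  by apply/qpi_eq; rewrite qreprK.
exists t => //; rewrite [ltRHS]splitr -[v](subrK w) addrAC.
by apply: le_lt_trans (ler_normD _ _) _; rewrite ltrD.
Qed.

HB.instance Definition _ := @Lmodule_isNormed.Build R[i] nquot nquot_norm
  nquot_normD (infnormZ cost_ne cost_ge0 costZ) nquot_norm_eq0.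

End NormedQuotient.

Section C0.
Variable R : realType.

Definition cvg_to0 : {pred nat -> R[i]^o} :=
  [pred a | `[< a @ \oo --> (0 : R[i]^o) >]].

Lemma cvg_to0_submod : submod_closed cvg_to0.
Proof.
split=> [|k a b /asboolP a0 /asboolP b0]; apply/asboolP; first exact: cvg_cst.
rewrite -[0 : R[i]^o](addr0 (0 : R[i]^o)); apply: cvgD => //.
by rewrite -[0 : R[i]^o](scaler0 (R[i]^o) k); exact: cvgZr.
Qed.

HB.instance Definition _ := GRing.isSubmodClosed.Build R[i] (nat -> R[i]^o)
  cvg_to0 cvg_to0_submod.

Record c0 := C0 { c0_val :> nat -> R[i]^o; c0_valP : c0_val \in cvg_to0 }.

HB.instance Definition _ := [isSub for c0_val].
HB.instance Definition _ := [Choice of c0 by <:].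
HB.instance Definition _ := [SubChoice_isSubLmodule of c0 by <:].

Lemma c0_cvg (a : c0) : a n @[n --> \oo] --> (0 : R[i]^o).
Proof. exact/asboolP/c0_valP. Qed.

Definition c0_norm (a : c0) : R[i] :=
  (sup (range (fun n => rnorm (a n))))%:C.

Let c0_has_sup (a : c0) : has_sup (range (fun n => rnorm (a n))).
Proof.
split; first by exists (rnorm (a 0%N)), 0%N.
have [N _ aN] := cvgr0_norm_lt _ (c0_cvg a) _ (@ltr01 R[i]).
exists (1 + \sum_(i < N) rnorm (a i)) => _ [n _ <-].
have [Nn|nN] := leqP N n.
  apply: ler_wpDr; first by apply: sumr_ge0 => i _; exact: rnorm_ge0.
  by rewrite -lecR rnormE ltW//; exact: aN.
rewrite (bigD1 (Ordinal nN))//= addrCA lerDl addr_ge0//.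
by apply: sumr_ge0 => i _; exact: rnorm_ge0.
Qed.

Lemma c0_norm_ub (a : c0) n : `|a n| <= c0_norm a.
Proof.
by rewrite -rnormE lecR; apply: ub_le_sup; [case: (c0_has_sup a)|exists n].
Qed.

Lemma c0_norm_le (a : c0) (M : R) :
  (forall n, `|a n| <= M%:C) -> c0_norm a <= M%:C.
Proof.
move=> aM; rewrite lecR; apply: ge_sup; first by case: (c0_has_sup a).
by move=> _ [n _ <-]; rewrite -lecR rnormE.
Qed.

Let c0_normD a b : c0_norm (a + b) <= c0_norm a + c0_norm b.
Proof.
rewrite /c0_norm -rmorphD; apply: c0_norm_le => n /=.
by rewrite rmorphD (le_trans (ler_normD _ _))// lerD// c0_norm_ub.
Qed.

Let c0_norm_ge0 a : 0 <= c0_norm a.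
Proof. exact: le_trans (c0_norm_ub a 0%N). Qed.

Let c0_normZ_le k a : c0_norm (k *: a) <= `|k| * c0_norm a.
Proof.
rewrite -(RRe_real (normr_real k)) /c0_norm -rmorphM; apply: c0_norm_le => n /=.
rewrite normrM rmorphM/= (RRe_real (normr_real k)) ler_wpM2l//.
exact: c0_norm_ub.
Qed.

Let c0_normZ k a : c0_norm (k *: a) = `|k| * c0_norm a.
Proof.
apply/eqP; rewrite eq_le c0_normZ_le/=.
have [->|k0] := eqVneq k 0; first by rewrite normr0 mul0r c0_norm_ge0.
rewrite -ler_pdivlMl ?normr_gt0// -normfV.
by apply: le_trans (c0_normZ_le _ _); rewrite scalerA mulVf// scale1r.
Qed.

Let c0_norm_eq0 a : c0_norm a = 0 -> a = 0.
Proof.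
move=> a0; apply: val_inj; apply/funext => n /=.
by apply/normr0_eq0/eqP; rewrite eq_le normr_ge0 andbT -a0 c0_norm_ub.
Qed.

HB.instance Definition _ := @Lmodule_isNormed.Build R[i] c0 c0_norm
  c0_normD c0_normZ c0_norm_eq0.

Let c0_mul_subproof (a b : c0) :
  (fun n => (a n : R[i]) * b n : R[i]^o) \in cvg_to0.
Proof.
apply/asboolP; rewrite -[0 : R[i]^o](mul0r (0 : R[i]^o)).
by apply: (@cvgM R[i]); exact: c0_cvg.
Qed.

Definition c0_mul (a b : c0) : c0 := C0 (c0_mul_subproof a b).

End C0.

HB.mixin Record NormedModule_isC0Module (R : realType) X
    & NormedModule R[i] X := {
  c0act : c0 R -> X -> X;
  c0actDl : forall a b x, c0act (a + b) x = c0act a x + c0act b x;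
  c0actDr : forall a x y, c0act a (x + y) = c0act a x + c0act a y;
  c0actZl : forall (k : R[i]) a x, c0act (k *: a) x = k *: c0act a x;
  c0actZr : forall (k : R[i]) a x, c0act a (k *: x) = k *: c0act a x;
  c0actM : forall a b x, c0act (c0_mul a b) x = c0act a (c0act b x);
  c0act_contractive : forall a x, `|c0act a x| <= `|a| * `|x|
}.

#[short(type="c0ModType")]
HB.structure Definition C0Module (R : realType) :=
  {X of NormedModule R[i] X & NormedModule_isC0Module R X}.

Section ModuleTensor.
Variables (R : realType) (X Z : c0ModType R).

Definition balanced_rel : set (ptensor X Z) := [set w |
  exists a x z, w = ptens (c0act a x) z - ptens x (c0act a z)].

Definition mtensor := nquot balanced_rel.
HB.instance Definition _ := NormedModule.on mtensor.

Definition mtens (x : X) (z : Z) : mtensor := nqpi balanced_rel (ptens x z).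

End ModuleTensor.

Section Morphisms.
Variables (R : realType) (X Y : c0ModType R).

Definition c0_morphism (phi : {linear X -> Y}) :=
  forall (a : c0 R) x, phi (c0act a x) = c0act a (phi x).

Definition bounded_operator (phi : {linear X -> Y}) :=
  exists M : R, forall x, `|phi x| <= M%:C * `|x|.

Definition topologically_injective (phi : {linear X -> Y}) :=
  bounded_operator phi /\
  exists c : R, 0 < c /\ forall x, c%:C * `|x| <= `|phi x|.

End Morphisms.

Section MapTensor.
Variables (R : realType) (X Y Z : c0ModType R) (phi : {linear X -> Y}).

Definition ptensor_map : ptensor X Z -> ptensor Y Z :=
  tlift (fun x z => ptens (phi x) z).

(* Computed on a chosen representative; by mtensor_mapE below the result does
   not depend on the choice when phi is a bounded morphism. *)
Definition mtensor_map (t : mtensor X Z) : mtensor Y Z :=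
  nqpi _ (ptensor_map (qrepr t)).

Let bDl x y (z : Z) : ptens (phi (x + y)) z = ptens (phi x) z + ptens (phi y) z.
Proof. by rewrite linearD /ptens tensDl. Qed.
Let bDr x (z t : Z) : ptens (phi x) (z + t) = ptens (phi x) z + ptens (phi x) t.
Proof. by rewrite /ptens tensDr. Qed.
Let bZl k x (z : Z) : ptens (phi (k *: x)) z = k *: ptens (phi x) z.
Proof. by rewrite linearZ /ptens/= tensZl. Qed.
Let bZr k x (z : Z) : ptens (phi x) (k *: z) = k *: ptens (phi x) z.
Proof. by rewrite /ptens tensZr. Qed.

Lemma ptensor_map_linear : linear ptensor_map.
Proof. exact: tlift_is_linear bDl bDr bZl bZr. Qed.

HB.instance Definition _ := GRing.isLinear.Build R[i] (ptensor X Z)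
  (ptensor Y Z) _ ptensor_map ptensor_map_linear.

Lemma ptensor_map_ptens x z : ptensor_map (ptens x z) = ptens (phi x) z.
Proof. exact: tliftE bDl bDr bZl bZr _ _. Qed.

Hypotheses (phi_mor : c0_morphism phi) (phi_bd : bounded_operator phi).

Lemma ptensor_map_bounded : exists2 M : R, 0 < M &
  forall u, `|ptensor_map u| <= M%:C * `|u|.
Proof.
have [M0 phiM0] := phi_bd; pose M := `|M0| + 1.
have Mp : 0 < M by rewrite ltr_wpDl.
have phiM x : rnorm (phi x) <= M * rnorm x.
  rewrite -lecR rmorphM/= !rnormE; apply: le_trans (phiM0 x) _.
  by rewrite ler_wpM2r// lecR ler_wpDr// ler_norm.
exists M => // u; rewrite -!rnormE -rmorphM lecR.
have -> : rnorm (ptensor_map u) = inf (ptensor_cost (ptensor_map u)) by [].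
have -> : rnorm u = inf (ptensor_cost u) by [].
rewrite -ler_pdivrMl//; apply: lb_le_inf.
  have [s us] := tens_sum u.
  by exists (\sum_(p <- s) rnorm p.1 * rnorm p.2), s.
move=> _ [s [-> ->]]; rewrite ler_pdivrMl//.
apply: (@le_trans _ _ (\sum_(p <- s) rnorm (phi p.1) * rnorm p.2)).
  apply: ge_inf.
    exists 0 => _ [t [_ ->]]; apply: sumr_ge0 => p _.
    by rewrite mulr_ge0 ?rnorm_ge0.
  exists [seq (phi p.1, p.2) | p <- s]; rewrite !big_map; split=> //.
  by rewrite linear_sum; apply: eq_bigr => p _; exact: ptensor_map_ptens.
rewrite mulr_sumr; apply: ler_sum => p _.
by rewrite mulrA ler_wpM2r ?rnorm_ge0.
Qed.

Lemma ptensor_map_balanced u : u \in closed_lspan (@balanced_rel R X Z) ->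
  ptensor_map u \in closed_lspan (@balanced_rel R Y Z).
Proof.
have [M M0 mapM] := ptensor_map_bounded.
have MC0 : 0 < M%:C :> R[i] by rewrite ltcR.
move=> /closed_lspanP uA; apply/closed_lspanP => e e0.
have [w /asboolP[s [sA ->]] uw] := uA _ (divr_gt0 e0 MC0).
exists (ptensor_map (\sum_(p <- s) p.1 *: p.2)).
  rewrite linear_sum big_seq rpred_sum// => p /sA[a [x [z pE]]].
  rewrite linearZ rpredZ// pE linearB/= !ptensor_map_ptens phi_mor.
  by apply: sub_lspan; exists a, (phi x), z.
rewrite -linearB; apply: le_lt_trans (mapM _) _.
by rewrite -ltr_pdivlMl// mulrC.
Qed.

Lemma mtensor_mapE u :
  mtensor_map (nqpi _ u) = nqpi _ (ptensor_map u).
Proof.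
apply/qpi_eq; rewrite -linearB; apply: ptensor_map_balanced.
by apply/qpi_eq; rewrite qreprK.
Qed.

Lemma mtensor_map_linear : linear mtensor_map.
Proof.
move=> k s t; rewrite -[s]qreprK -[t]qreprK -[k *: _ + _]linearP.
by rewrite !mtensor_mapE linearP /nqpi linearP.
Qed.

Lemma mtensor_map_mtens x z : mtensor_map (mtens x z) = mtens (phi x) z.
Proof. by rewrite /mtens mtensor_mapE ptensor_map_ptens. Qed.

End MapTensor.

(* Main.v *)
Require Import Defs.
From HB Require Import structures.
From mathcomp Require Import all_boot all_order all_algebra.
From mathcomp Require Import complex.
From mathcomp Require Import all_classical all_reals topology normedtype.
From mathcomp Require Import ring.

(** Why the theorem holds.

Write N_Y for the closed span of the balanced relations in Y (x) Z, and e_k,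
P_n for the indicator sequences of {k} and of {0, ..., n-1} in c_0.  Let u be a
tensor in X (x) Z with (phi (x) 1) u in N_Y; it must be shown that u lies in
N_X.  The tensor products are not completed, so u is a finite sum of
elementary tensors, and kernels of maps T (x) S can be described
algebraically: if (T (x) S) u = 0 then u is a sum of elementary tensors x (x) z
with T x = 0 or S z = 0 ([ptensor_map2_ker]).  This is applied twice, to two
bounded maps that vanish on N_Y.

The block map e_k (x) e_k kills balanced relations, because e_k a = a_k e_k
([block_balanced]).  It commutes with phi (x) 1, which is injective since phi
is; hence every block of u vanishes.

The other map is Y (x) Z -> Y/Y_0 (x) Z/Z_0, where V_0 denotes the closure of
c_0 V: it kills balanced relations since both factors are annihilated by c_0
([nqpi_c0_range_balanced]).  So u is a sum of tensors x (x) z with phi x in Y_0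
or z in Z_0.  As V_0 consists of the v with P_n v -> v, and phi is bounded
below, phi x in Y_0 forces x in X_0 ([topologically_injective_c0_range]).

Consequently u is the limit of the tensors obtained by truncating, in each
term, the factor that lies in X_0 or Z_0.  Modulo balanced relations,
P_n x (x) z and x (x) P_n z are both equal to the sum of the blocks
e_k x (x) e_k z over k < n ([ptens_truncl_blocks], [ptens_truncr_blocks]), so
these approximants are equivalent to sums of blocks of u, that is, to 0.  Hence
u is a limit of elements of the span of the balanced relations. *)

Set Implicit Arguments.
Unset Strict Implicit.
Unset Printing Implicit Defensive.

Import Order.TTheory GRing.Theory Num.Theory.

Local Open Scope classical_set_scope.
Local Open Scope ring_scope.
Local Open Scope complex_scope.

(** * Tensor products of two linear maps *)

Section LinearInstances.
Variable R : realType.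

HB.instance Definition _ (V : normedModType R[i]) (A : set V) :=
  GRing.isLinear.Build R[i] V (nquot A) _ (@nqpi R V A)
    (qpi_is_linear (closed_lspan A)).

Variable X : c0ModType R.

Lemma c0act_linear (a : c0 R) : linear (c0act (s := X) a).
Proof. by move=> k x y; rewrite c0actDr c0actZr. Qed.

HB.instance Definition _ (a : c0 R) :=
  GRing.isLinear.Build R[i] X X _ (c0act (s := X) a) (c0act_linear a).

End LinearInstances.

Lemma ptens0r (R : realType) (X Z : normedModType R[i]) (x : X) :
  ptens x (0 : Z) = 0.
Proof. by rewrite /ptens -(scale0r (0 : Z)) tensZr scale0r. Qed.

Section TensorOfMaps.
Variables (R : realType) (X X' Z Z' : normedModType R[i]).
Variables (T : {linear X -> X'}) (S : {linear Z -> Z'}).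

Definition ptensor_map2 : ptensor X Z -> ptensor X' Z' :=
  tlift (fun x z => ptens (T x) (S z)).

Let bDl x y (z : Z) :
  ptens (T (x + y)) (S z) = ptens (T x) (S z) + ptens (T y) (S z).
Proof. by rewrite linearD /ptens tensDl. Qed.
Let bDr x (z t : Z) :
  ptens (T x) (S (z + t)) = ptens (T x) (S z) + ptens (T x) (S t).
Proof. by rewrite linearD /ptens tensDr. Qed.
Let bZl k x (z : Z) : ptens (T (k *: x)) (S z) = k *: ptens (T x) (S z).
Proof. by rewrite linearZ /ptens/= tensZl. Qed.
Let bZr k x (z : Z) : ptens (T x) (S (k *: z)) = k *: ptens (T x) (S z).
Proof. by rewrite linearZ /ptens/= tensZr. Qed.

Lemma ptensor_map2_linear : linear ptensor_map2.
Proof. exact: tlift_is_linear bDl bDr bZl bZr. Qed.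

HB.instance Definition _ := GRing.isLinear.Build R[i] (ptensor X Z)
  (ptensor X' Z') _ ptensor_map2 ptensor_map2_linear.

Lemma ptensor_map2_ptens x z : ptensor_map2 (ptens x z) = ptens (T x) (S z).
Proof. exact: tliftE bDl bDr bZl bZr _ _. Qed.

Lemma ptensor_map2_sum (s : seq (X * Z)) :
  ptensor_map2 (\sum_(p <- s) ptens p.1 p.2)
  = \sum_(p <- s) ptens (T p.1) (S p.2).
Proof.
by rewrite linear_sum; apply: eq_bigr => p _; exact: ptensor_map2_ptens.
Qed.

Lemma ptensor_map2_contractive :
  (forall x, `|T x| <= `|x|) -> (forall z, `|S z| <= `|z|) ->
  forall u, `|ptensor_map2 u| <= `|u|.
Proof.
move=> T1 S1 u; rewrite -!rnormE lecR.
have -> : rnorm (ptensor_map2 u) = inf (ptensor_cost (ptensor_map2 u)) by [].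
have -> : rnorm u = inf (ptensor_cost u) by [].
apply: lb_le_inf.
  have [s us] := tens_sum u.
  by exists (\sum_(p <- s) rnorm p.1 * rnorm p.2), s.
move=> _ [s [-> ->]].
apply: (@le_trans _ _ (\sum_(p <- s) rnorm (T p.1) * rnorm (S p.2))).
  apply: ge_inf.
    by exists 0 => _ [t [_ ->]]; apply: sumr_ge0 => p _;
      rewrite mulr_ge0 ?rnorm_ge0.
  by exists [seq (T p.1, S p.2) | p <- s]; rewrite !big_map ptensor_map2_sum.
apply: ler_sum => p _; rewrite ler_pM ?rnorm_ge0//.
  by rewrite -lecR !rnormE T1.
by rewrite -lecR !rnormE S1.
Qed.

(** Induction on the number of terms of a representation of u.  If T x <> 0 for
    the first term x (x) z, a functional f with f (T x) = 1 contracts the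
    relation (T (x) S) u = 0 into S z + sum_i f (T x_i) S z_i = 0.  So z may be
    corrected by the z_i to some z0 in the kernel of S, at the price of
    replacing each x_i by x_i - f (T x_i) x: one term fewer remains. *)
Lemma ptensor_map2_ker u : ptensor_map2 u = 0 ->
  exists s : seq (X * Z), u = \sum_(p <- s) ptens p.1 p.2 /\
    forall p, p \in s -> T p.1 = 0 \/ S p.2 = 0.
Proof.
have [s0 ->] := tens_sum u; move: s0.
suff main n (s : seq (X * Z)) : (size s <= n)%N ->
    \sum_(p <- s) ptens (T p.1) (S p.2) = 0 ->
    exists s' : seq (X * Z), \sum_(p <- s) ptens p.1 p.2
      = \sum_(p <- s') ptens p.1 p.2 /\
      forall p, p \in s' -> T p.1 = 0 \/ S p.2 = 0.
  by move=> s; rewrite ptensor_map2_sum; exact: main (leqnn _).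
elim: n s => [|n ih] [|[x z] s]//=; [by exists [::]|by exists [::]|].
rewrite ltnS => sn.
have [Tx0|Tx0] := eqVneq (T x) 0.
  rewrite big_cons/= Tx0 /ptens tens0l add0r => /(ih _ sn)[s' [sE s'K]].
  exists ((x, z) :: s'); rewrite !big_cons /ptens sE; split=> // p.
  by rewrite inE => /predU1P[->/=|/s'K//]; left.
have [f [flin fx _]] := separating_functional Tx0.
pose b (y : X') (t : Z') : Z' := (f y : R[i]) *: t.
have fD y y' : f (y + y') = f y + f y' by have := flin 1 y y'; rewrite !scale1r.
have f0 : f 0 = 0 by apply: (addrI (f 0)); rewrite -fD !addr0.
have fZ k y : f (k *: y) = (k : R[i]) * f y.
  by have := flin k y 0; rewrite f0 !addr0.
have bDl' y y' t : b (y + y') t = b y t + b y' t by rewrite /b fD scalerDl.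
have bDr' y t t' : b y (t + t') = b y t + b y t' by rewrite /b scalerDr.
have bZl' k y t : b (k *: y) t = k *: b y t by rewrite /b fZ scalerA.
have bZr' k y t : b y (k *: t) = k *: b y t by rewrite /b !scalerA mulrC.
pose F : ptensor X' Z' -> Z' := tlift b.
have Flin : linear F := tlift_is_linear bDl' bDr' bZl' bZr'.
have FD u' v : F (u' + v) = F u' + F v.
  by have := Flin 1 u' v; rewrite !scale1r.
have F0 : F 0 = 0 by apply: (addrI (F 0)); rewrite -FD !addr0.
have FE y t : F (ptens y t) = b y t by rewrite /F /ptens tliftE.
have Fsum (l : seq (X * Z)) : F (\sum_(p <- l) ptens (T p.1) (S p.2))
    = S (\sum_(p <- l) (f (T p.1) : R[i]) *: p.2).
  elim: l => [|p l IH]; first by rewrite !big_nil F0 linear0.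
  by rewrite !big_cons FD IH linearD linearZ FE.
move=> sum0.
pose z0 := z + \sum_(p <- s) (f (T p.1) : R[i]) *: p.2.
have Sz0 : S z0 = 0.
  by have := Fsum ((x, z) :: s); rewrite sum0 F0 big_cons/= fx scale1r.
pose t := [seq (p.1 - (f (T p.1) : R[i]) *: x, p.2) | p <- s].
(* Stated for arbitrary A, B because it is needed for T, S, to apply the
   induction hypothesis, and for the identities, to rewrite u itself. *)
have split_sum (W V : normedModType R[i]) (A : {linear X -> W})
    (B : {linear Z -> V}) :
    \sum_(p <- (x, z) :: s) ptens (A p.1) (B p.2)
    = ptens (A x) (B z0) + \sum_(p <- t) ptens (A p.1) (B p.2).
  rewrite big_cons/= /z0 linearD /ptens tensDr -addrA; congr (_ + _).
  rewrite /t; elim: (s) => [|p l IH].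
    by rewrite !big_nil linear0 -/(ptens (A x) 0) ptens0r add0r.
  rewrite /= !big_cons IH linearD linearZ/= linearB linearZ/=.
  rewrite tensDr tensDl tensZr -scaleNr tensZl scaleNr.
  by rewrite [RHS]addrACA (addrC (_ *: tens (A x) (B p.2))) subrK.
have [||s' [tE s'K]] := ih t; first by rewrite size_map.
  by move: sum0; rewrite split_sum Sz0 ptens0r add0r.
exists ((x, z0) :: s'); split.
  by have /= -> := split_sum _ _ idfun idfun; rewrite tE big_cons.
by move=> p; rewrite inE => /predU1P[->/=|/s'K//]; right.
Qed.

End TensorOfMaps.

(** * Bounds in quotients and tensor products *)

Section Contractions.
Variable R : realType.

Lemma nqpi_eq0 (V : normedModType R[i]) (A : set V) v :
  (nqpi A v = 0) <-> (v \in closed_lspan A).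
Proof.
rewrite -[0](linear0 (@nqpi R V A)).
by split=> [/qpi_eq|vA]; [rewrite subr0|apply/qpi_eq; rewrite subr0].
Qed.

Lemma nqpi_contractive (V : normedModType R[i]) (A : set V) v :
  `|nqpi A v| <= `|v|.
Proof.
rewrite -!rnormE lecR.
have -> : rnorm (nqpi A v) = inf (nquot_cost (nqpi A v)) by [].
apply: ge_inf; last by exists v.
by exists 0 => _ [w [_ ->]]; exact: rnorm_ge0.
Qed.

Lemma ptens_norm_le (X Z : normedModType R[i]) (x : X) (z : Z) :
  `|ptens x z| <= `|x| * `|z|.
Proof.
rewrite -!rnormE -rmorphM lecR.
have -> : rnorm (ptens x z) = inf (ptensor_cost (ptens x z)) by [].
apply: ge_inf; last by exists [:: (x, z)]; rewrite !big_seq1.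
exists 0 => _ [w [_ ->]]; apply: sumr_ge0 => p _.
by rewrite mulr_ge0 ?rnorm_ge0.
Qed.

Lemma contractive_closed_lspan0 (V W : normedModType R[i]) (A : set V)
    (F : {linear V -> W}) :
  (forall v, `|F v| <= `|v|) -> (forall v, A v -> F v = 0) ->
  forall v, v \in closed_lspan A -> F v = 0.
Proof.
move=> F1 FA v /closed_lspanP vA.
apply/normr0_eq0/eqP; rewrite eq_le normr_ge0 andbT.
apply/ler_addgt0Pr => e e0; rewrite add0r.
have [w /asboolP[s [sA ->]] vw] := vA e e0.
have Fw : F (\sum_(p <- s) p.1 *: p.2) = 0.
  by rewrite linear_sum big_seq big1// => p /sA /FA; rewrite linearZ/= => ->;
    rewrite scaler0.
by rewrite -[F v]subr0 -Fw -linearB (le_trans (F1 _))// ltW.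
Qed.

End Contractions.

(** * Indicator sequences acting on a module *)

Section Indicator.
Variable R : realType.

Lemma c0_indicator_subproof (D : seq nat) :
  (fun k => (k \in D)%:R : R[i]^o) \in @cvg_to0 R.
Proof.
apply/asboolP; apply: cvg_near_cst; exists (\max_(k <- D) k).+1 => // k /= Dk.
have [kD|//] := boolP (k \in D).
by have := leq_bigmax_seq (P := xpredT) (F := id) _ kD isT; rewrite leqNgt Dk.
Qed.

Definition c0_indicator (D : seq nat) : c0 R := C0 (c0_indicator_subproof D).

Lemma c0_mul_indicator1 (a : c0 R) k :
  c0_mul a (c0_indicator [:: k]) = a k *: c0_indicator [:: k].
Proof.
apply: val_inj; apply/funext => i.
rewrite -[LHS]/(a i * (i \in [:: k])%:R : R[i]).
rewrite -[RHS]/(a k * (i \in [:: k])%:R : R[i]).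
by rewrite !inE; case: eqP => [->//|_]; rewrite !mulr0.
Qed.

Lemma c0_mulC (a b : c0 R) : c0_mul a b = c0_mul b a.
Proof. by apply: val_inj; apply/funext => i /=; rewrite mulrC. Qed.

Lemma c0_indicator_norm D : `|c0_indicator D| <= 1.
Proof.
apply: (c0_norm_le (M := 1)) => k /=; case: (k \in D); first by rewrite normr1.
by rewrite normr0 ler01.
Qed.

Variable X : c0ModType R.

Lemma c0act_indicator_contractive D (x : X) :
  `|c0act (c0_indicator D) x| <= `|x|.
Proof.
apply: le_trans (c0act_contractive _ _) _.
by rewrite ler_piMl// c0_indicator_norm.
Qed.

Lemma c0act_indicator1 k (a : c0 R) (x : X) :
  c0act (c0_indicator [:: k]) (c0act a x)
  = a k *: c0act (c0_indicator [:: k]) x.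
Proof. by rewrite -c0actM c0_mulC c0_mul_indicator1 c0actZl. Qed.

Lemma c0act_indicator_sum n (x : X) :
  c0act (c0_indicator (iota 0 n)) x
  = \sum_(k < n) c0act (c0_indicator [:: val k]) x.
Proof.
elim: n => [|n ih].
  rewrite big_ord0 -(scale0r (c0act (c0_indicator [::]) x)) -c0actZl.
  by congr (c0act _ x); apply: val_inj; apply/funext => i /=; rewrite scale0r.
rewrite big_ord_recr/= -ih -c0actDl; congr (c0act _ x).
apply: val_inj; apply/funext => i.
rewrite -[LHS]/((i \in iota 0 n.+1)%:R : R[i]).
rewrite -[RHS]/((i \in iota 0 n)%:R + (i \in [:: n])%:R : R[i]).
rewrite !mem_iota !inE !add0n/= ltnS -natrD.
by case: ltngtP.
Qed.

Lemma c0_indicator_cvg (a : c0 R) :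
  c0_mul (c0_indicator (iota 0 n)) a @[n --> \oo] --> a.
Proof.
apply/cvgrPdist_le => e e0.
have eE : (complex.Re e)%:C = e by rewrite RRe_real// gtr0_real.
have [N _ aN] := cvgr0_norm_le _ (c0_cvg a) _ e0.
exists N => // n /= Nn; rewrite -eE; apply: c0_norm_le => k.
rewrite -[leLHS]/(`|(a k : R[i]) - (k \in iota 0 n)%:R * a k|).
rewrite mem_iota/= add0n; case: ltnP => [_|nk].
  by rewrite mul1r subrr normr0 eE ltW.
by rewrite mul0r subr0 eE; apply: aN; exact: leq_trans Nn nk.
Qed.

(** Its closed span is the essential part of the module, the largest submodule
    on which the truncations are an approximate identity. *)
Definition c0_range : set X := [set w | exists (a : c0 R) x, w = c0act a x].

(** For a in c_0 the truncations P_n a converge to a, which gives the limit on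
    the span of c_0 X; it passes to the closure because all the P_n are
    contractions. *)
Lemma c0_range_cvg (x : X) : x \in closed_lspan c0_range ->
  c0act (c0_indicator (iota 0 n)) x @[n --> \oo] --> x.
Proof.
move=> /closed_lspanP xA.
have cvgA w : w \in lspan c0_range ->
    c0act (c0_indicator (iota 0 n)) w @[n --> \oo] --> w.
  move=> /asboolP[s [sA ->]]; elim: s sA => [|p s ih] sA.
    rewrite big_nil; under eq_cvg do rewrite linear0; exact: cvg_cst.
  rewrite big_cons; under eq_cvg do rewrite linearD linearZ/=.
  apply: cvgD; last first.
    by apply: ih => q qs; apply: sA; rewrite inE qs orbT.
  apply: cvgZr; have [|a [y ->]] := sA p; first by rewrite mem_head.
  apply/cvgrPdist_le => e e0.
  have d0 : 0 < e / (`|y| + 1) by rewrite divr_gt0// ltr_wpDl.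
  have /cvgrPdist_le/(_ _ d0) := @c0_indicator_cvg a.
  apply: filterS => n an; rewrite -c0actM.
  have -> : c0act a y - c0act (c0_mul (c0_indicator (iota 0 n)) a) y
    = c0act (a - c0_mul (c0_indicator (iota 0 n)) a) y.
    by rewrite c0actDl; congr (_ + _); rewrite -scaleN1r -c0actZl scaleN1r.
  apply: le_trans (c0act_contractive _ _) _.
  apply: le_trans (ler_wpM2r _ an) _ => //.
  by rewrite mulrAC ler_pdivrMr ?ltr_wpDl// ler_pM2l// lerDl.
apply/cvgrPdist_le => e e0.
have e3 : 0 < e / 3%:R by rewrite divr_gt0.
have [w wA xw] := xA _ e3.
have /cvgrPdist_le/(_ _ e3) := @cvgA _ wA.
apply: filterS => n wn.
rewrite -(subrK w x) linearD/= opprD addrACA.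
apply: le_trans (ler_normD _ _) _.
have -> : e = (e / 3%:R + e / 3%:R) + e / 3%:R by field.
rewrite lerD//; apply: le_trans (ler_normB _ _) _.
by rewrite lerD ?ltW// (le_lt_trans (c0act_indicator_contractive _ _)).
Qed.

End Indicator.

Arguments c0_range {R} X.

(** * Recovering a tensor from its blocks *)

Section Reconstruction.
Variables (R : realType) (X Z : c0ModType R).

(** The k-th block only sees the fibres e_k X and e_k Z, on which c_0 acts by the
    scalars a_k: there the module tensor product is the plain tensor product. *)
Definition block k : ptensor X Z -> ptensor X Z :=
  ptensor_map2 (c0act (c0_indicator R [:: k])) (c0act (c0_indicator R [:: k])).
HB.instance Definition _ k := GRing.Linear.on (block k).

Lemma block_balanced k u : u \in closed_lspan (@balanced_rel R X Z) ->
  block k u = 0.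
Proof.
apply: contractive_closed_lspan0.
  by apply: ptensor_map2_contractive; exact: c0act_indicator_contractive.
move=> _ [a [x [z ->]]].
rewrite linearB/= /block !ptensor_map2_ptens/= !c0act_indicator1.
by rewrite /ptens tensZl tensZr subrr.
Qed.

(** The part of the module tensor product invisible to all blocks: after
    dividing by the essential parts, c_0 acts as 0 and no relation is left. *)
Lemma nqpi_c0_range_balanced (u : ptensor X Z) :
  u \in closed_lspan (@balanced_rel R X Z) ->
  ptensor_map2 (nqpi (c0_range X)) (nqpi (c0_range Z)) u = 0.
Proof.
have nq0 (V : c0ModType R) a (v : V) : nqpi (c0_range V) (c0act a v) = 0.
  by apply/nqpi_eq0/asboolP/subset_closure/sub_lspan; exists a, v.
apply: contractive_closed_lspan0.
  by apply: ptensor_map2_contractive; exact: nqpi_contractive.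
move=> _ [a [x [z ->]]]; rewrite linearB/= !ptensor_map2_ptens/= !nq0.
by rewrite ptens0r /ptens tens0l subrr.
Qed.

Local Notation P n := (c0_indicator R (iota 0 n)).
Local Notation e k := (c0_indicator R [:: k]).
Local Notation balanced := (lspan (@balanced_rel R X Z)).

Lemma c0_indicator1_idem (V : c0ModType R) k (v : V) :
  c0act (e k) (c0act (e k) v) = c0act (e k) v.
Proof. by rewrite c0act_indicator1 /= mem_head scale1r. Qed.

(** Since e_k is idempotent, e_k x (x) z = e_k (e_k x) (x) z, which is balanced
    with e_k x (x) e_k z. *)
Lemma ptens_truncl_blocks n x z :
  ptens (c0act (P n) x) z - \sum_(k < n) block k (ptens x z) \in balanced.
Proof.
have -> : ptens (c0act (P n) x) z = \sum_(k < n) ptens (c0act (e (val k)) x) z.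
  rewrite c0act_indicator_sum; elim/big_rec2: _ => [|k y t _ <-].
    by rewrite /ptens tens0l.
  by rewrite /ptens tensDl.
rewrite -sumrB rpred_sum// => k _; rewrite /block ptensor_map2_ptens/=.
rewrite -{1}c0_indicator1_idem; apply: sub_lspan.
by exists (e (val k)), (c0act (e (val k)) x), z.
Qed.

Lemma ptens_truncr_blocks n x z :
  ptens x (c0act (P n) z) - \sum_(k < n) block k (ptens x z) \in balanced.
Proof.
have -> : ptens x (c0act (P n) z) = \sum_(k < n) ptens x (c0act (e (val k)) z).
  rewrite c0act_indicator_sum; elim/big_rec2: _ => [|k y t _ <-].
    by rewrite ptens0r.
  by rewrite /ptens tensDr.
rewrite -sumrB rpred_sum// => k _; rewrite /block ptensor_map2_ptens/=.
rewrite -{1}c0_indicator1_idem -opprB -scaleN1r rpredZ//; apply: sub_lspan.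
by exists (e (val k)), x, (c0act (e (val k)) z).
Qed.

(** The approximants are required to be equivalent to the partial sums of blocks
    before any closure is taken: this exact form is additive in u, and it turns
    the vanishing of all blocks into membership in the algebraic span. *)
Definition block_approximable (u : ptensor X Z) :=
  exists w : nat -> ptensor X Z,
  w @ \oo --> u /\ forall n, w n - \sum_(k < n) block k u \in balanced.

Lemma cvg_ptensl (y : nat -> X) x (z : Z) :
  y @ \oo --> x -> ptens (y n) z @[n --> \oo] --> ptens x z.
Proof.
move=> /cvgrPdist_le yx; apply/cvgrPdist_le => d d0.
have c0 : 0 < `|z| + 1 by rewrite ltr_wpDl.
have := yx _ (divr_gt0 d0 c0); apply: filterS => n yn.
have -> : ptens x z - ptens (y n) z = ptens (x - y n) z.
  by rewrite /ptens tensDl -[in RHS]scaleN1r tensZl scaleN1r.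
apply: le_trans (ptens_norm_le _ _) _; apply: le_trans (ler_wpM2r _ yn) _ => //.
by rewrite mulrAC ler_pdivrMr// ler_pM2l// lerDl.
Qed.

Lemma cvg_ptensr (y : nat -> Z) (x : X) z :
  y @ \oo --> z -> ptens x (y n) @[n --> \oo] --> ptens x z.
Proof.
move=> /cvgrPdist_le yz; apply/cvgrPdist_le => d d0.
have c0 : 0 < `|x| + 1 by rewrite ltr_wpDl.
have := yz _ (divr_gt0 d0 c0); apply: filterS => n yn.
have -> : ptens x z - ptens x (y n) = ptens x (z - y n).
  by rewrite /ptens tensDr -[in RHS]scaleN1r tensZr scaleN1r.
apply: le_trans (ptens_norm_le _ _) _; apply: le_trans (ler_wpM2l _ yn) _ => //.
by rewrite mulrCA ler_piMr ?(ltW d0)// ler_pdivrMr// mul1r lerDl.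
Qed.

Lemma block_approximable_sum (s : seq (X * Z)) :
  (forall p, p \in s -> p.1 \in closed_lspan (c0_range X) \/
                        p.2 \in closed_lspan (c0_range Z)) ->
  block_approximable (\sum_(p <- s) ptens p.1 p.2).
Proof.
elim: s => [|[x z] s ih] sE.
  exists (fun=> 0); rewrite big_nil; split; first exact: cvg_cst.
  by move=> n; rewrite big1 ?subrr ?rpred0// => k _; rewrite linear0.
have [|w [wcvg wE]] := ih.
  by move=> p ps; apply: sE; rewrite inE ps orbT.
have [t [tcvg tE]] : block_approximable (ptens x z).
  have [/c0_range_cvg xc|/c0_range_cvg zc] := sE (x, z) (mem_head _ _).
    exists (fun n => ptens (c0act (P n) x) z); split; first exact: cvg_ptensl.
    by move=> n; exact: ptens_truncl_blocks.
  exists (fun n => ptens x (c0act (P n) z)); split; first exact: cvg_ptensr.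
  by move=> n; exact: ptens_truncr_blocks.
exists (fun n => t n + w n); rewrite big_cons; split; first exact: cvgD.
move=> n; rewrite (eq_bigr _ (fun (k : 'I_n) _ => linearD (block k) _ _)).
by rewrite big_split opprD addrACA rpredD.
Qed.

Lemma block_approximable_balanced u : block_approximable u ->
  (forall k, block k u = 0) -> u \in closed_lspan (@balanced_rel R X Z).
Proof.
move=> [w [/cvgrPdist_lt wu wE]] u0; apply/closed_lspanP => d d0.
have [N _ wN] := wu _ d0; exists (w N); last exact: wN (leqnn _).
by have := wE N; rewrite big1 ?subr0// => k _; rewrite u0.
Qed.

End Reconstruction.

(** * Reflecting balanced tensors along a topologically injective morphism *)

Section TopologicallyInjective.
Variables (R : realType) (X Y Z : c0ModType R) (phi : {linear X -> Y}).
Hypotheses (phi_mor : c0_morphism phi) (phi_inj : topologically_injective phi).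

Lemma topologically_injective_eq0 x : phi x = 0 -> x = 0.
Proof.
have [_ [c [c0 cphi]]] := phi_inj => phix0.
have := cphi x; rewrite phix0 normr0 pmulr_rle0 ?ltcR//.
by rewrite normr_le0 => /eqP.
Qed.

(** Here boundedness from below is essential: the distance from P_n x to x is
    controlled by the distance from P_n (phi x) = phi (P_n x) to phi x. *)
Lemma topologically_injective_c0_range x :
  phi x \in closed_lspan (c0_range Y) -> x \in closed_lspan (c0_range X).
Proof.
have [_ [c [c0 cphi]]] := phi_inj.
have cC0 : 0 < c%:C :> R[i] by rewrite ltcR.
move=> /c0_range_cvg/cvgrPdist_lt phix; apply/closed_lspanP => d d0.
have [N _ /(_ N (leqnn _)) phiN] := phix _ (mulr_gt0 cC0 d0).
exists (c0act (c0_indicator R (iota 0 N)) x).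
  by apply: sub_lspan; exists (c0_indicator R (iota 0 N)), x.
rewrite -(ltr_pM2l cC0); apply: le_lt_trans phiN.
by apply: le_trans (cphi _) _; rewrite linearB/= phi_mor.
Qed.

Lemma ptensor_map_balanced_reflect u :
  ptensor_map phi u \in closed_lspan (@balanced_rel R Y Z) ->
  u \in closed_lspan (@balanced_rel R X Z).
Proof.
move=> phiu.
have map2E (W V : normedModType R[i]) (A : {linear Y -> W})
    (B : {linear Z -> V}) :
    ptensor_map2 (A \o phi) B u = ptensor_map2 A B (ptensor_map phi u).
  have [s ->] := tens_sum u; rewrite ptensor_map2_sum.
  rewrite (linear_sum (ptensor_map phi)) linear_sum; apply: eq_bigr => p _.
  by rewrite -/(ptens p.1 p.2) /= ptensor_map_ptens /= ptensor_map2_ptens.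
have blocku k : block k u = 0.
  have /ptensor_map2_ker[s [-> sK]] : ptensor_map2 phi idfun (block k u) = 0.
    rewrite -[RHS](block_balanced k phiu) /block -map2E.
    have [s ->] := tens_sum u; rewrite !ptensor_map2_sum linear_sum.
    by apply: eq_bigr => p _; rewrite /= ptensor_map2_ptens/= phi_mor.
  rewrite big_seq big1// => p /sK[/topologically_injective_eq0->|/= ->].
    by rewrite /ptens tens0l.
  by rewrite ptens0r.
apply: block_approximable_balanced => //.
(* Taking the kernel of the composite of phi with the quotient map of Y, rather
   than of a quotient of phi, yields terms with phi x in the essential part. *)
have := nqpi_c0_range_balanced phiu; rewrite -map2E.
move=> /ptensor_map2_ker[s [-> sK]].
apply: block_approximable_sum => p /sK[/nqpi_eq0|/nqpi_eq0 zA]; last by right.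
by left; exact: topologically_injective_c0_range.
Qed.

End TopologicallyInjective.

Theorem theorem2p4 (R : realType) (X Y Z : c0ModType R) (phi : {linear X -> Y})
    (phi_mor : c0_morphism phi) (phi_inj : topologically_injective phi) :
  injective (mtensor_map phi : mtensor X Z -> mtensor Y Z).
Proof.
move=> s t /qpi_eq; rewrite -linearB.
move=> /(ptensor_map_balanced_reflect phi_mor phi_inj)/qpi_eq.
by rewrite !qreprK.
Qed.
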